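(* A complex symplectic Lie algebra $(\mathfrak g,J,\omega)$ is a solution of the complex symplectic cotangent extension problem if and only if it admits a $J$-invariant Lagrangian ideal.
   Context: A complex structure on a real Lie algebra is $J\in\operatorname{End}(\mathfrak g)$ with $J^2=-\mathrm{Id}$ and vanishing Nijenhuis tensor $N_J(X,Y)=[X,Y]+J[JX,Y]+J[X,JY]-[JX,JY]$. A complex symplectic Lie algebra $(\mathfrak g,J,\omega)$ is a real Lie algebra with a complex structure $J$ and a closed non-degenerate $2$-form $\omega$ (symplectic form) such that $\omega(JX,Y)=\omega(X,JY)$ for all $X,Y$. An isomorphism of complex symplectic Lie algebras $(\mathfrak g,J,\omega)\to(\mathfrak g',J',\omega')$ is a Lie algebra isomorphism $\phi$ with $\phi J=J'\phi$ and $\phi^*\omega'=\omega$. Let $\mathfrak h$ be a real Lie algebra with a complex structure $J$ and $\mathfrak h^*=\operatorname{Hom}(\mathfrak h,\mathbb R)$, $(J^*\varphi)(X)=\varphi(JX)$. On the vector space $\mathfrak h^*\oplus\mathfrak h$ set $$\mathbf\Omega\big((\varphi,X),(\psi,Y)\big)=\varphi(Y)-\psi(X),\qquad\mathbf J(\varphi,X)=(J^*\varphi,JX).$$ The complex symplectic cotangent extension problem consists in finding a Lie algebra structure on $\mathfrak h^*\oplus\mathfrak h$ such that: (1) $0\to\mathfrak h^*\to\mathfrak h^*\oplus\mathfrak h\to\mathfrak h\to0$ is an exact sequence of Lie algebras, $\mathfrak h^*$ being endowed with the Abelian Lie algebra structure; (2) $d\mathbf\Omega=0$; (3) $N_{\mathbf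 J}=0$. A complex symplectic Lie algebra $(\mathfrak g,J,\omega)$ is a solution of the problem if it is isomorphic, as a complex symplectic Lie algebra, to one of the form $(\mathfrak h^*\oplus\mathfrak h,\mathbf J,\mathbf\Omega)$ with such a Lie algebra structure, for some $(\mathfrak h,J)$. *)

(* Defs.v *)
From HB Require Import structures.
From mathcomp Require Import all_boot all_order all_algebra.
From mathcomp Require Import reals.

Set Implicit Arguments.
Unset Strict Implicit.
Unset Printing Implicit Defensive.

Import GRing.Theory.
Local Open Scope ring_scope.

Record lie_structure (R : realType) (V : vectType R) := LieStructure {
  bracket :> {bilinear V -> V -> V};
  bracket_alternating : forall X, bracket X X = 0;
  bracket_jacobi : forall X Y Z,
    bracket X (bracket Y Z) + bracket Y (bracket Z X)
      + bracket Z (bracket X Y) = 0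
}.

Section AbelianLie.
Variables (R : realType) (V : vectType R).

Definition zero_bracket (X Y : V) : V := 0.

Fact zero_bracket_bilinear : bilinear_for
  (GRing.Scale.Law.clone _ _ *:%R _) (GRing.Scale.Law.clone _ _ *:%R _)
  zero_bracket.
Proof. by split=> ? ? ? ? /=; rewrite /zero_bracket scaler0 addr0. Qed.

HB.instance Definition _ := bilinear_isBilinear.Build R V V V _ _
  zero_bracket zero_bracket_bilinear.

Fact zero_bracket_alternating (X : V) : zero_bracket X X = 0.
Proof. by []. Qed.

Fact zero_bracket_jacobi (X Y Z : V) :
  zero_bracket X (zero_bracket Y Z) + zero_bracket Y (zero_bracket Z X)
    + zero_bracket Z (zero_bracket X Y) = 0.
Proof. by rewrite /zero_bracket !addr0. Qed.

Definition abelian_lie : lie_structure V :=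
  LieStructure zero_bracket_alternating zero_bracket_jacobi.

End AbelianLie.

Arguments abelian_lie {R} V.

Section LieAlgebras.
Variable R : realType.

Definition lie_hom (V W : vectType R) (L : lie_structure V)
    (M : lie_structure W) (f : 'Hom(V, W)) : Prop :=
  forall X Y, f (L X Y) = M (f X) (f Y).

Definition lie_short_exact (A E Q : vectType R) (LA : lie_structure A)
    (LE : lie_structure E) (LQ : lie_structure Q)
    (i : 'Hom(A, E)) (p : 'Hom(E, Q)) : Prop :=
  [/\ lie_hom LA LE i, lie_hom LE LQ p, lker i = 0%VS, limg i = lker p
    & limg p = fullv].

Variables (V : vectType R) (L : lie_structure V).

Definition lie_ideal (a : {vspace V}) : Prop :=
  forall X Y, Y \in a -> L X Y \in a.

Definition nijenhuis (J : 'End(V)) (X Y : V) : V :=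
  L X Y + J (L (J X) Y) + J (L X (J Y)) - L (J X) (J Y).

Definition complex_structure (J : 'End(V)) : Prop :=
  (J \o J)%VF = - \1%VF /\ forall X Y, nijenhuis J X Y = 0.

(* Chevalley-Eilenberg differential of a 2-form.  Over the reals a
   skew-symmetric bilinear form is the same thing as an alternating one. *)
Definition d2form (omega : {skew_symmetric V}) (X Y Z : V) : R :=
  - omega (L X Y) Z + omega (L X Z) Y - omega (L Y Z) X.

Definition closed_form (omega : {skew_symmetric V}) : Prop :=
  forall X Y Z, d2form omega X Y Z = 0.

Definition symplectic_form (omega : {skew_symmetric V}) : Prop :=
  closed_form omega /\ nondegenerate omega.

Definition complex_symplectic (J : 'End(V)) (omega : {skew_symmetric V}) :
    Prop :=
  [/\ complex_structure J, symplectic_form omega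
    & forall X Y, omega (J X) Y = omega X (J Y)].

End LieAlgebras.

(* [orthov omega a] is the symplectic orthogonal of [a]. *)
Definition lagrangian (R : realType) (V : vectType R)
    (omega : {skew_symmetric V}) (a : {vspace V}) : Prop :=
  orthov omega a = a.

Definition J_invariant (R : realType) (V : vectType R) (J : 'End(V))
    (a : {vspace V}) : Prop :=
  (J @: a <= a)%VS.

Definition cs_isomorphism (R : realType) (V W : vectType R)
    (L : lie_structure V) (J : 'End(V)) (omega : {skew_symmetric V})
    (L' : lie_structure W) (J' : 'End(W)) (omega' : {skew_symmetric W})
    (phi : 'Hom(V, W)) : Prop :=
  [/\ bijective phi, lie_hom L L' phi, (phi \o J)%VF = (J' \o phi)%VF
    & forall X Y, omega' (phi X) (phi Y) = omega X Y].

Section CotangentExtension.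
Variables (R : realType) (h : vectType R).

Definition dual : vectType R := 'Hom(h, R^o).

Definition cotangent : vectType R := (dual * h)%type.

Definition cot_inj_fun (f : dual) : cotangent := (f, 0).

Fact cot_inj_linear : linear cot_inj_fun.
Proof.
by move=> a f f'; congr pair; rewrite /= scaler0 addr0.
Qed.

HB.instance Definition _ :=
  GRing.isLinear.Build R dual cotangent _ cot_inj_fun cot_inj_linear.

Definition cot_inj : 'Hom(dual, cotangent) := linfun cot_inj_fun.

Definition cot_proj_fun (u : cotangent) : h := u.2.

Fact cot_proj_linear : linear cot_proj_fun.
Proof. by []. Qed.

HB.instance Definition _ :=
  GRing.isLinear.Build R cotangent h _ cot_proj_fun cot_proj_linear.

Definition cot_proj : 'Hom(cotangent, h) := linfun cot_proj_fun.

(* [(u.1 \o J)%VF] is the transpose of [J] applied to [u.1]. *)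
Definition cot_J_fun (J : 'End(h)) (u : cotangent) : cotangent :=
  ((u.1 \o J)%VF, J u.2).

Fact cot_J_linear J : linear (cot_J_fun J).
Proof.
move=> a u v; rewrite /cot_J_fun; congr pair; last by rewrite /= linearP.
by rewrite /= comp_lfunDl comp_lfunZl.
Qed.

HB.instance Definition _ J :=
  GRing.isLinear.Build R cotangent cotangent _ (cot_J_fun J) (cot_J_linear J).

Definition cot_J (J : 'End(h)) : 'End(cotangent) := linfun (cot_J_fun J).

Definition cot_Omega_fun (u v : cotangent) : R := u.1 v.2 - v.1 u.2.

Fact cot_Omega_fun_bilinear : bilinear_for
  (GRing.Scale.Law.clone _ _ *%R _) (GRing.Scale.Law.clone _ _ (idfun \; *%R) _)
  cot_Omega_fun.
Proof.
by split=> w a u v; rewrite /cot_Omega_fun /= linearP lfunE /= lfunE /=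
  mulrBr opprD addrACA.
Qed.

HB.instance Definition _ := bilinear_isBilinear.Build R cotangent cotangent R
  _ _ cot_Omega_fun cot_Omega_fun_bilinear.

Fact cot_Omega_fun_skew (u v : cotangent) :
  cot_Omega_fun u v = (-1) ^+ true * idfun (cot_Omega_fun v u).
Proof. by rewrite /cot_Omega_fun /= expr1 mulN1r opprB. Qed.

HB.instance Definition _ :=
  isHermitianSesquilinear.Build R cotangent true idfun cot_Omega_fun cot_Omega_fun_skew.

Definition cot_Omega : {skew_symmetric cotangent} := cot_Omega_fun.

Lemma cot_injE f : cot_inj f = (f, 0).
Proof. by rewrite lfunE. Qed.

Lemma cot_projE u : cot_proj u = u.2.
Proof. by rewrite lfunE. Qed.

Lemma cot_JE J u : cot_J J u = ((u.1 \o J)%VF, J u.2).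
Proof. by rewrite lfunE. Qed.

Definition cs_cotangent_extension (Lh : lie_structure h) (J : 'End(h))
    (L : lie_structure cotangent) : Prop :=
  [/\ lie_short_exact (abelian_lie dual) L Lh cot_inj cot_proj,
      closed_form L cot_Omega
    & forall u v, nijenhuis L (cot_J J) u v = 0].

End CotangentExtension.

Definition cs_cotangent_solution (R : realType) (g : vectType R)
    (L : lie_structure g) (J : 'End(g)) (omega : {skew_symmetric g}) : Prop :=
  exists (h : vectType R) (Lh : lie_structure h) (Jh : 'End(h)),
    complex_structure Lh Jh /\
    exists L' : lie_structure (cotangent h),
      cs_cotangent_extension Lh Jh L' /\
      exists phi : 'Hom(g, cotangent h),
        cs_isomorphism L J omega L' (cot_J Jh) (cot_Omega h) phi.

(* Main.v *)
Require Import Defs.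
From HB Require Import structures.
From mathcomp Require Import all_boot all_order all_algebra.
From mathcomp Require Import reals.
From mathcomp Require Import ring.

(** Solution implies ideal: inside h^* + h the subspace h^* is an ideal, because
it is the kernel of the projection onto h; it is invariant under the extended
complex structure, and it is its own orthogonal, because linear forms separate
the points of h.  Its preimage under the given isomorphism is the required
ideal ([cs_solution_lagrangian_ideal]).

Ideal implies solution: let [a] be a J-invariant Lagrangian ideal, h the
quotient g / a with its induced bracket and complex structure, [p] the
projection of g onto h.  Three facts make g look like h^* + h.
- [a] is abelian: closedness of omega expresses omega ([X, Y], Z), for X and Y
  in [a], through values of omega on [a], where it vanishes
  ([lagrangian_ideal_abelian]).
- [p] has a linear section [s] that commutes with the complex structures: the
  average of any section with its conjugate by J ([average_section]).
- The image of [s] may fail to be isotropic, which is repaired by half of the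
  defect: the map
    X |-> (v |-> omega (X - (1/2) s (p X), s v), p X)
  carries omega to the canonical form, hence is injective, and is onto because
  omega represents every linear form ([cot_model_Omega], [cot_model_onto]).  It
  commutes with the complex structures since J is self-adjoint for omega.
Carrying the bracket of g along this isomorphism gives the extension of h by the
abelian algebra h^*; closedness and integrability are carried along as well
([lagrangian_ideal_cs_solution]).

Passing to the quotient and carrying the bracket along the isomorphism are the
same construction, the push-forward of a bracket along a split surjection whose
kernel is an ideal ([push_lie]). *)

Set Implicit Arguments.
Unset Strict Implicit.
Unset Printing Implicit Defensive.

Import GRing.Theory.
Local Open Scope ring_scope.

(** * Push-forward of Lie algebra structures *)

Section LieBasics.
Variables (R : realType) (V : vectType R) (L : lie_structure V).

Lemma bracketC X Y : L X Y = - L Y X.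
Proof.
have := bracket_alternating L (X + Y).
rewrite linearDl !linearDr !bracket_alternating add0r addr0.
by move/eqP; rewrite addr_eq0 => /eqP.
Qed.

Lemma lie_ideal_left (a : {vspace V}) X Y :
  lie_ideal L a -> X \in a -> L X Y \in a.
Proof. by move=> ida Xa; rewrite bracketC rpredN ida. Qed.

End LieBasics.

Section Pushforward.
Variables (R : realType) (V W : vectType R) (L : lie_structure V).
Variables (f : 'Hom(V, W)) (s : 'Hom(W, V)).

(** When the kernel of [f] is an ideal and [s] is a section of [f], this is the
bracket on [W], identified with the quotient of [V] by the kernel of [f]. *)
Definition push_bracket (u v : W) : W := f (L (s u) (s v)).

Fact push_bracket_bilinear : bilinear_for
  (GRing.Scale.Law.clone _ _ *:%R _) (GRing.Scale.Law.clone _ _ *:%R _)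
  push_bracket.
Proof.
split=> w c u v /=; rewrite /push_bracket.
  by rewrite [s _]linearP linearDl linearZl_LR linearP.
by rewrite [s (_ + _)]linearP linearPr linearP.
Qed.

HB.instance Definition _ := bilinear_isBilinear.Build R W W W _ _
  push_bracket push_bracket_bilinear.

Hypotheses (fs : cancel s f) (ker_ideal : lie_ideal L (lker f)).

(** The value does not depend on the representatives: changing one of them by an
element of the kernel changes the bracket by an element of the kernel. *)
Lemma push_bracketE X Y : f (L X Y) = push_bracket (f X) (f Y).
Proof.
have kerB Z : Z - s (f Z) \in lker f by rewrite memv_ker linearB /= fs subrr.
have {1}-> : X = s (f X) + (X - s (f X)) by rewrite addrC subrK.
have {1}-> : Y = s (f Y) + (Y - s (f Y)) by rewrite addrC subrK.
rewrite linearDl linearD /= [X in _ + X](_ : _ = 0); last first.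
  by apply/eqP; rewrite -memv_ker lie_ideal_left.
rewrite linearDr linearD /= [X in _ + X + _](_ : _ = 0) ?addr0 //.
by apply/eqP; rewrite -memv_ker ker_ideal.
Qed.

Fact push_bracket_alternating X : push_bracket X X = 0.
Proof. by rewrite /push_bracket bracket_alternating linear0. Qed.

Fact push_bracket_jacobi X Y Z :
  push_bracket X (push_bracket Y Z) + push_bracket Y (push_bracket Z X)
    + push_bracket Z (push_bracket X Y) = 0.
Proof.
rewrite -[X]fs -[Y]fs -[Z]fs -!push_bracketE -!linearD.
by rewrite bracket_jacobi linear0.
Qed.

Definition push_lie : lie_structure W :=
  LieStructure push_bracket_alternating push_bracket_jacobi.

Lemma push_lie_hom : lie_hom L push_lie f.
Proof. exact: push_bracketE. Qed.

End Pushforward.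

Section Homs.
Variables (R : realType) (V W : vectType R).
Variables (L : lie_structure V) (M : lie_structure W).
Variables (f : 'Hom(V, W)) (J : 'End(V)) (K : 'End(W)).

Lemma lie_hom_ker_ideal : lie_hom L M f -> lie_ideal L (lker f).
Proof. by move=> fh X Y; rewrite !memv_ker fh => /eqP->; rewrite linear0r. Qed.

Lemma hom_nijenhuis X Y : lie_hom L M f -> (forall Z, f (J Z) = K (f Z)) ->
  f (nijenhuis L J X Y) = nijenhuis M K (f X) (f Y).
Proof. by move=> fh fJ; rewrite !(linearB, linearD) /= !fJ !fh !fJ. Qed.

Lemma hom_closed (omega : {skew_symmetric V}) (eta : {skew_symmetric W}) :
    lie_hom L M f -> (forall X Y, eta (f X) (f Y) = omega X Y) ->
    (forall w, exists X, w = f X) ->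
  closed_form L omega -> closed_form M eta.
Proof.
move=> fh fo f_onto clo u v w.
have [X ->] := f_onto u; have [Y ->] := f_onto v; have [Z ->] := f_onto w.
by rewrite /d2form -!fh !fo; apply: clo.
Qed.

End Homs.

(** * Non-degenerate skew forms and Lagrangian subspaces *)

Section Symplectic.
Variables (R : realType) (V : vectType R) (omega : {skew_symmetric V}).

Lemma skewC X Y : omega X Y = - omega Y X.
Proof. by rewrite hermC /= expr1 mulN1r. Qed.

Lemma nondegenerate_eq0 X :
  nondegenerate omega -> (forall Y, omega X Y = 0) -> X = 0.
Proof.
move=> /eqP nd X0; apply/eqP; rewrite -memv0 -nd.
by apply/mem_orthovP => Y _; exact: X0.
Qed.

Definition skew_flat_fun X : 'Hom(V, R^o) := linfun (omega X : V -> R^o).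

Fact skew_flat_linear : linear skew_flat_fun.
Proof.
move=> c X Y; apply/lfunP => Z.
by rewrite add_lfunE scale_lfunE !lfunE /= linearDl linearZl_LR.
Qed.

HB.instance Definition _ := GRing.isLinear.Build R V 'Hom(V, R^o) _
  skew_flat_fun skew_flat_linear.

(** The map from [V] to its dual given by [omega] is injective, and both spaces
have the same dimension. *)
Lemma nondegenerate_riesz (f : 'Hom(V, R^o)) : nondegenerate omega ->
  exists X, forall Y, f Y = omega X Y.
Proof.
move=> nd; pose F := linfun skew_flat_fun.
have kF : (fullv :&: lker F)%VS = 0%VS.
  apply/eqP; rewrite -subv0; apply/subvP => X.
  rewrite memv_cap memv_ker lfunE /= => /andP[_ /eqP X0].
  rewrite memv0; apply/eqP/nondegenerate_eq0 => // Y.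
  by have /lfunP/(_ Y) := X0; rewrite !lfunE.
have : f \in limg F.
  suff -> : limg F = fullv by rewrite memvf.
  apply/eqP; rewrite eqEdim subvf (limg_dim_eq kF) !dimvf /=.
  by rewrite /dim /= muln1.
case/memv_imgP => X _ ->; exists X => Y.
by rewrite !lfunE.
Qed.

Lemma lagrangian_isotropic (a : {vspace V}) X Y :
  lagrangian omega a -> X \in a -> Y \in a -> omega X Y = 0.
Proof. by move=> lag; rewrite -{1}lag => /mem_orthovP; apply. Qed.

(** Closedness at [X], [Y] and any [Z] leaves only [omega (L X Y) Z], as the other
two terms pair elements of [a]. *)
Lemma lagrangian_ideal_abelian (L : lie_structure V) (a : {vspace V}) X Y :
    closed_form L omega -> nondegenerate omega ->
    lagrangian omega a -> lie_ideal L a ->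
  X \in a -> Y \in a -> L X Y = 0.
Proof.
move=> clo nd lag ida Xa Ya.
apply: (nondegenerate_eq0 nd) => Z; apply: oppr_inj; rewrite oppr0.
have iso U V' := @lagrangian_isotropic a U V' lag.
have := clo X Y Z; rewrite /d2form (iso (L X Z)) ?lie_ideal_left //.
by rewrite (iso (L Y Z)) ?lie_ideal_left // addr0 subr0.
Qed.

End Symplectic.

(** * Quotients and equivariant sections *)

(** The quotient of [V] by [a] is realised on a complement of [a]. *)
Lemma quotient_split (R : realType) (V : vectType R) (a : {vspace V}) :
  exists (h : vectType R) (p : 'Hom(V, h)) (s : 'Hom(h, V)),
    cancel s p /\ lker p = a.
Proof.
pose W := (a^C)%VS.
exists (subvs_of W), (linfun (vsproj W) \o (\1 - projv a))%VF.
exists (linfun vsval); split.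
  move=> w; rewrite comp_lfunE add_lfunE opp_lfunE id_lfunE !lfunE /=.
  have /eqP -> : projv a (vsval w) == 0.
    by rewrite -memv_ker lker_proj subvsP.
  by rewrite subr0 vsvalK.
apply/vspaceP => X; rewrite memv_ker comp_lfunE add_lfunE opp_lfunE id_lfunE.
rewrite lfunE /= -(inj_eq val_inj) /= vsprojK ?memv_projC // subr_eq0.
apply/eqP/idP => [->|Xa]; first exact: memv_proj.
by rewrite projv_id.
Qed.


Section EquivariantSplitting.
Variables (R : realType) (V h : vectType R) (J : 'End(V)).
Variables (p : 'Hom(V, h)) (s : 'Hom(h, V)).
Hypotheses (JJ : (J \o J)%VF = - \1%VF) (sK : cancel s p).
Hypothesis kerJ : J_invariant J (lker p).

Definition quotient_J : 'End(h) := (p \o J \o s)%VF.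

Lemma invol_opp X : J (J X) = - X.
Proof. by rewrite -comp_lfunE JJ opp_lfunE id_lfunE. Qed.

(** This is where the invariance of the kernel is needed: [X] and [s (p X)] differ
by an element of the kernel, hence so do their images under [J]. *)
Lemma proj_J X : p (J X) = quotient_J (p X).
Proof.
rewrite !comp_lfunE; apply/eqP; rewrite -subr_eq0 -!linearB /= -memv_ker.
apply: (subvP kerJ); apply: memv_img.
by rewrite memv_ker linearB /= sK subrr.
Qed.

Lemma quotient_J_opp v : quotient_J (quotient_J v) = - v.
Proof. by rewrite -[v]sK -!proj_J invol_opp linearN. Qed.

(** The average of [s] and of its conjugate by the complex structures, which is
[- J s quotient_J], since the inverse of [quotient_J] is [- quotient_J]. *)
Definition average_section : 'Hom(h, V) :=
  2^-1 *: (s - (J \o s \o quotient_J)%VF).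

Lemma average_sectionE v :
  average_section v = 2^-1 *: (s v - J (s (quotient_J v))).
Proof. by rewrite scale_lfunE add_lfunE opp_lfunE !comp_lfunE. Qed.

Lemma average_sectionK : cancel average_section p.
Proof.
move=> v; rewrite average_sectionE linearZ linearB /= proj_J !sK.
rewrite quotient_J_opp opprK -mulr2n -scaler_nat scalerA mulVf ?scale1r //.
by rewrite Num.Theory.pnatr_eq0.
Qed.

Lemma average_section_J v :
  J (average_section v) = average_section (quotient_J v).
Proof.
rewrite !average_sectionE linearZ linearB /= invol_opp opprK.
by rewrite quotient_J_opp !linearN /= opprK addrC.
Qed.

End EquivariantSplitting.

(** * The isomorphism with the cotangent model *)

Lemma dual_separates (R : realType) (h : vectType R) (v : h) :
  (forall f : dual h, f v = 0) -> v = 0.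
Proof.
move=> fv0; rewrite (coord_vbasis (memvf v)) big1 // => i _.
have := fv0 (linfun (coord (vbasis {:h}) i : h -> R^o)).
by rewrite lfunE /= => ->; rewrite scale0r.
Qed.

Section CotangentModel.
Variables (R : realType) (g h : vectType R) (omega : {skew_symmetric g}).
Variables (p : 'Hom(g, h)) (s : 'Hom(h, g)).

(** The coefficient one half splits the defect [omega (s v) (s w)] evenly between
its two arguments, so that antisymmetrising the first component gives back
[omega]. *)
Definition cot_model_fun (X : g) : cotangent h :=
  ((skew_flat_fun omega (X - 2^-1 *: s (p X)) \o s)%VF, p X).

Fact cot_model_linear : linear cot_model_fun.
Proof.
move=> c X Y; congr pair; last by rewrite /= linearP.
have -> : c *: X + Y - 2^-1 *: s (p (c *: X + Y))
    = c *: (X - 2^-1 *: s (p X)) + (Y - 2^-1 *: s (p Y)).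
  rewrite [p _]linearP [s _]linearP /= scalerDr opprD addrACA scalerBr.
  by rewrite !scalerA mulrC.
apply/lfunP => v /=; rewrite add_lfunE scale_lfunE !comp_lfunE !lfunE /=.
by rewrite linearDl linearZl_LR.
Qed.

HB.instance Definition _ := GRing.isLinear.Build R g (cotangent h) _
  cot_model_fun cot_model_linear.

Definition cot_model : 'Hom(g, cotangent h) := linfun cot_model_fun.

Lemma cot_model1E X v :
  (cot_model X).1 v = omega X (s v) - 2^-1 * omega (s (p X)) (s v).
Proof.
by rewrite lfunE /= comp_lfunE lfunE /= linearBl linearZl_LR.
Qed.

Lemma cot_model2E X : (cot_model X).2 = p X.
Proof. by rewrite lfunE. Qed.

Hypotheses (sK : cancel s p) (lag : lagrangian omega (lker p)).

(** The difference of the two sides is [omega (X - s (p X)) (Y - s (p Y))], a value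
of [omega] on the Lagrangian kernel of [p]. *)
Lemma cot_model_Omega X Y : cot_Omega h (cot_model X) (cot_model Y) = omega X Y.
Proof.
have kerB Z : Z - s (p Z) \in lker p by rewrite memv_ker linearB /= sK subrr.
have := lagrangian_isotropic lag (kerB X) (kerB Y).
rewrite linearBl !linearBr /cot_Omega /= /cot_Omega_fun !cot_model1E !cot_model2E.
rewrite (skewC omega Y) (skewC omega (s (p Y)) (s (p X))) => e.
by apply/eqP; rewrite -subr_eq0 -oppr_eq0 -e; apply/eqP; field.
Qed.

(** A preimage of [(f, w)] has the form [Z + s w] with [Z] in the kernel of [p].
The condition on [Z] prescribes [omega Z] as a linear form that factors through
[p]; non-degeneracy gives such a [Z], and it lies in the kernel because the
kernel is its own orthogonal. *)
Lemma cot_model_onto u : nondegenerate omega -> exists X, u = cot_model X.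
Proof.
case: u => f w nd.
have [Z Zq] := nondegenerate_riesz
  ((f - 2^-1 *: (skew_flat_fun omega (s w) \o s)) \o p)%VF nd.
have {Zq} ZE Y : omega Z Y = f (p Y) - 2^-1 * omega (s w) (s (p Y)).
  by rewrite -Zq comp_lfunE add_lfunE opp_lfunE scale_lfunE comp_lfunE lfunE.
have Zker : Z \in lker p.
  rewrite -lag; apply/mem_orthovP => Y; rewrite memv_ker ZE => /eqP->.
  by rewrite !linear0 mulr0 subr0.
have pX : p (Z + s w) = w.
  by rewrite linearD /= sK; move: Zker; rewrite memv_ker => /eqP->; rewrite add0r.
exists (Z + s w).
rewrite [RHS]surjective_pairing cot_model2E pX; congr pair.
apply/lfunP => v; rewrite cot_model1E pX linearDl /= ZE !sK.
by field.
Qed.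

Lemma cot_model_bij : nondegenerate omega -> bijective cot_model.
Proof.
move=> nd.
have ker0 : lker cot_model == 0%VS.
  rewrite -subv0; apply/subvP => X; rewrite memv_ker memv0 => /eqP X0.
  apply/eqP/(nondegenerate_eq0 nd) => Y.
  by rewrite -cot_model_Omega X0 linear0l.
exists (cot_model^-1)%VF; first exact: lker0_lfunK.
move=> u; have [X ->] := cot_model_onto u nd.
by rewrite lker0_lfunK.
Qed.

End CotangentModel.

(** * The two implications *)

Section Solution.
Variables (R : realType) (g : vectType R) (L : lie_structure g).
Variables (J : 'End(g)) (omega : {skew_symmetric g}).

Lemma cs_solution_lagrangian_ideal : cs_cotangent_solution L J omega ->
  exists a : {vspace g}, [/\ J_invariant J a, lagrangian omega a & lie_ideal L a].
Proof.
case=> h [Lh [Jh [_ [L' [[[_ pr_hom _ _ _] _ _] [phi]]]]]].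
case=> [[psi phiK psiK] phi_hom phiJ phi_omega].
pose p := (cot_proj h \o phi)%VF.
have pE X : p X = (phi X).2 by rewrite comp_lfunE cot_projE.
exists (lker p); split.
- apply/subvP => _ /memv_imgP[X Xp ->]; move: Xp; rewrite !memv_ker !pE.
  by rewrite -comp_lfunE phiJ comp_lfunE cot_JE /= => /eqP->; rewrite linear0.
- apply/vspaceP => X; rewrite memv_ker pE; apply/mem_orthovP/eqP; last first.
    move=> X0 Y; rewrite memv_ker pE => /eqP Y0.
    by rewrite -phi_omega /cot_Omega /= /cot_Omega_fun X0 Y0 !linear0 addr0.
  (* Pair X with the preimage of each vertical vector (f, 0). *)
  move=> X0; apply: dual_separates => f.
  have pV : p (psi (cot_inj h f)) = 0 by rewrite pE psiK cot_injE.
  have := X0 (psi (cot_inj h f)); rewrite memv_ker pV eqxx => /(_ isT).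
  rewrite -phi_omega psiK cot_injE /cot_Omega /= /cot_Omega_fun /= linear0 sub0r.
  by move/eqP; rewrite oppr_eq0 => /eqP.
- apply: (@lie_hom_ker_ideal _ _ _ L Lh) => X Y.
  by rewrite comp_lfunE phi_hom pr_hom !comp_lfunE.
Qed.

Lemma lagrangian_ideal_cs_solution (a : {vspace g}) :
    complex_symplectic L J omega ->
    J_invariant J a -> lagrangian omega a -> lie_ideal L a ->
  cs_cotangent_solution L J omega.
Proof.
move=> [[JJ NJ] [clo nd] oJ] aJ lag ida.
have [h [p [s0 [s0K kerp]]]] := quotient_split a.
subst a.
pose Jh := quotient_J J p s0; pose s := average_section J p s0.
have sK : cancel s p := average_sectionK JJ s0K aJ.
have pJ : forall X, p (J X) = Jh (p X) := proj_J s0K aJ.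
have sJ : forall v, J (s v) = s (Jh v) := average_section_J JJ s0K aJ.
have JhJh v : Jh (Jh v) = - v := quotient_J_opp JJ s0K aJ v.
pose Lh := push_lie sK ida.
pose phi := cot_model omega p s.
have [psi phiK psiK] : bijective phi := cot_model_bij sK lag nd.
have phi0 : lker phi == 0%VS by apply/lker0P/can_inj/phiK.
have phi_onto u : exists X, u = phi X by exists (psi u).
have phiVK : cancel (phi^-1)%VF phi.
  by move=> u; have [X ->] := phi_onto u; rewrite lker0_lfunK.
have idphi : lie_ideal L (lker phi).
  by move=> X Y; rewrite (eqP phi0) !memv0 => /eqP->; rewrite linear0r.
pose L' := push_lie phiVK idphi.
have phi_hom : lie_hom L L' phi := push_lie_hom phiVK idphi.
have p_hom : lie_hom L Lh p := push_lie_hom sK ida.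
have phiJ X : phi (J X) = cot_J Jh (phi X).
  rewrite cot_JE [LHS]surjective_pairing !cot_model2E pJ; congr pair.
  apply/lfunP => v; rewrite comp_lfunE !cot_model1E -sJ pJ -sJ.
  by rewrite !oJ.
have phi_omega := cot_model_Omega sK lag.
exists h, Lh, Jh; split.
  split.
    by apply/lfunP => v; rewrite comp_lfunE JhJh opp_lfunE id_lfunE.
  by move=> u v; rewrite -[u]sK -[v]sK -(hom_nijenhuis _ _ p_hom pJ) NJ linear0.
exists L'; split; last first.
  exists phi; split=> //; first by exists psi.
  by apply/lfunP => X; rewrite !comp_lfunE phiJ.
split.
- split.
  + move=> f f'; rewrite linear0.
    have [X fX] := phi_onto (cot_inj h f); have [Y fY] := phi_onto (cot_inj h f').
    rewrite fX fY -phi_hom (lagrangian_ideal_abelian clo nd lag ida) ?linear0 //.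
      by rewrite memv_ker -(cot_model2E omega p s) -/phi -fX cot_injE.
    by rewrite memv_ker -(cot_model2E omega p s) -/phi -fY cot_injE.
  + move=> u v; have [X ->] := phi_onto u; have [Y ->] := phi_onto v.
    by rewrite -phi_hom !cot_projE !cot_model2E p_hom.
  + apply/eqP/lker0P => f f'; rewrite !cot_injE; by case.
  + apply/vspaceP => u; rewrite memv_ker cot_projE; apply/memv_imgP/eqP.
      by case=> f _ ->; rewrite cot_injE.
    by case: u => f w /= ->; exists f; rewrite ?memvf // cot_injE.
  + apply/vspaceP => v; rewrite memvf; apply/memv_imgP.
    by exists (0, v); rewrite ?memvf // cot_projE.
- exact: hom_closed phi_hom phi_omega phi_onto clo.
- move=> u v; have [X ->] := phi_onto u; have [Y ->] := phi_onto v.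
  by rewrite -(hom_nijenhuis _ _ phi_hom phiJ) NJ linear0.
Qed.

End Solution.

Theorem theorem5p7 (R : realType) (g : vectType R) (L : lie_structure g)
    (J : 'End(g)) (omega : {skew_symmetric g})
    (hg : complex_symplectic L J omega) :
  cs_cotangent_solution L J omega <->
  exists a : {vspace g},
    [/\ J_invariant J a, lagrangian omega a & lie_ideal L a].
Proof.
split; first exact: cs_solution_lagrangian_ideal.
by case=> a [aJ lag ida]; apply: lagrangian_ideal_cs_solution lag ida.
Qed.
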